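(* Let $(\mathfrak g_0,B_0,(\rho,V))$ be a fundamental triplet over $\mathbb C$ such that $\mathfrak g_0=Z(\mathfrak g_0)\oplus\mathfrak g_0'$ is reductive with one-dimensional center, $\mathfrak g_0'=[\mathfrak g_0,\mathfrak g_0]$, and $\rho(Z(\mathfrak g_0))=\mathbb C\,\mathrm{Id}_V$. Suppose that $\rho$ lifts to a representation $\pi$ of a connected complex algebraic group $G_0$ with Lie algebra $\mathfrak g_0$. Let $X\in V$ satisfy $X\notin\mathfrak g_0'.X=\{\rho(U)X\mid U\in\mathfrak g_0'\}$, and let $\mathcal O_X=G_0.X$. Define, for $x\in\mathcal O_X$, $$\varphi(x)=\{y\in V^*\mid (y,H_0,x)\text{ is an }\mathfrak{sl}_2\text{-triple}\}.$$ Then $\varphi(x)$ is a class modulo $(T_x)^\perp$ in $V^*$. Hence the map $$x\longmapsto\varphi(x)\in V^*/(T_x)^\perp\simeq T_x^*$$ is a section of the cotangent bundle $T^*(\mathcal O_X)$. Moreover this section is equivariant: $$\varphi(\pi(g).x)=\pi^*(g)\varphi(x)\qquad\text{for all } g\in G_0,\ x\in\mathcal O_X.$$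
   Context: All vector spaces and Lie algebras are over $\mathbb C$. A fundamental triplet $(\mathfrak g_0,B_0,(\rho,V))$ consists of a finite-dimensional Lie algebra $\mathfrak g_0$, a non-degenerate invariant symmetric bilinear form $B_0$ on $\mathfrak g_0$, and a finite-dimensional representation $(\rho,V)$ of $\mathfrak g_0$; $\rho^*$ and $\pi^*$ denote the contragredient representations on $V^*$. $\Gamma(\mathfrak g_0,B_0,\rho)=V^*\oplus\mathfrak g_0\oplus V$ (degrees $-1,0,1$) is the local Lie algebra with the bracket of $\mathfrak g_0$ and the anticommutative brackets $[U,X]=\rho(U)X$, $[U,Y]=\rho^*(U)Y$, and $[X,Y]\in\mathfrak g_0$ defined by $B_0([X,Y],U)=Y(\rho(U)X)$ for all $U\in\mathfrak g_0$ ($X\in V$, $Y\in V^*$). $\mathfrak{sl}_2$-triples are taken with respect to these brackets: $(y,h,x)$ is an $\mathfrak{sl}_2$-triple if $[h,x]=2x$, $[h,y]=-2y$, $[y,x]=h$. $H_0\in Z(\mathfrak g_0)$ is an element with $\rho(H_0)=2\,\mathrm{Id}_V$. $T_x=\mathfrak g_0.x=\{\rho(U)x\mid U\in\mathfrak g_0\}\subset V$ is the tangent space at $x$ to $\mathcal O_X$, $(T_x)^\perp=\{y\in V^*\mid y(T_x)=0\}$, and $T_x^*$ is canonically identified with $V^*/(T_x)^\perp$. *)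

(* Defs.v *)
From HB Require Import structures.
From mathcomp Require Import all_boot all_algebra.
From mathcomp Require Import classical_sets reals.
From mathcomp Require Export complex.
From mathcomp Require Import mpoly.

Set Implicit Arguments.
Unset Strict Implicit.
Unset Printing Implicit Defensive.

Import GRing.Theory.
Local Open Scope classical_set_scope.
Local Open Scope ring_scope.

(** * Finite-dimensional Lie algebras *)

HB.mixin Record Vector_isLie (K : fieldType) L of Vector K L := {
  lie : L -> L -> L;
  lie_bilinear : bilinear_for *:%R *:%R lie;
  liexx : forall x, lie x x = 0;
  lie_jacobi : forall x y z,
    lie x (lie y z) + lie y (lie z x) + lie z (lie x y) = 0
}.

#[short(type="lieAlgType")]
HB.structure Definition LieAlgebra (K : fieldType) :=
  {L of Vector K L & Vector_isLie K L}.

Section LieAlgebra.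
Variables (K : fieldType) (L : lieAlgType K).
Implicit Types (A B I H : {vspace L}).

HB.instance Definition _ :=
  bilinear_isBilinear.Build K L L L *:%R *:%R (@lie K L) (@lie_bilinear K L).
HB.instance Definition _ (x : L) :=
  GRing.isLinear.Build K L L *:%R (lie x) (lie_bilinear.2 x).

Definition ad (x : L) : 'End(L) := linfun (lie x).

Definition lie_center : {vspace L} := lker (linfun ad).

(* [A, B]: the span of all brackets; by bilinearity bases suffice. *)
Definition lie_prod A B : {vspace L} :=
  <<[seq lie u v | u <- vbasis A, v <- vbasis B]>>%VS.

Definition lie_derived : {vspace L} := lie_prod fullv fullv.

Definition lie_ideal H I := (I <= H)%VS /\ (lie_prod H I <= I)%VS.

Definition lie_solvable I :=
  exists k, iter k (fun J => lie_prod J J) I = 0%VS.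

(* [H] is a subalgebra; semisimple means that its radical is zero. *)
Definition lie_semisimple H :=
  forall I, lie_ideal H I -> lie_solvable I -> I = 0%VS.

Definition lie_reductive :=
  [/\ (lie_center + lie_derived = fullv)%VS,
      (lie_center :&: lie_derived = 0)%VS
    & lie_semisimple lie_derived].

Lemma adE x y : ad x y = lie x y.
Proof. by rewrite lfunE. Qed.

Lemma ad_is_linear : linear ad.
Proof.
by move=> a x y; apply/lfunP => z; rewrite add_lfunE scale_lfunE !adE linearPl.
Qed.

HB.instance Definition _ := GRing.isLinear.Build K L 'End(L) _ ad ad_is_linear.

Lemma lie_centerP x : reflect (forall y, lie x y = 0) (x \in lie_center).
Proof.
rewrite memv_ker lfunE /=; apply: (iffP eqP) => [adx0 y | x0].
  by have := congr1 (fun f : 'End(L) => f y) adx0; rewrite adE zero_lfunE.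
by apply/lfunP => y; rewrite adE x0 zero_lfunE.
Qed.

Lemma mem_lie_prod A B x y : x \in A -> y \in B -> lie x y \in lie_prod A B.
Proof.
move=> /coord_vbasis -> /coord_vbasis ->.
rewrite linear_sumlz memv_suml // => i _; rewrite linear_sumr memv_suml // => j _.
rewrite linearZl_LR linearZr_LR !memvZ // memv_span //.
by apply/allpairsP; exists ((vbasis A)`_i, (vbasis B)`_j); rewrite !mem_nth ?size_tuple.
Qed.

End LieAlgebra.


Notation dual K V := 'Hom(V, K^o).

(** * Fundamental triplets and their local Lie algebras *)

Section Triplet.
Variables (K : fieldType) (g : lieAlgType K) (V : vectType K).

Definition is_lie_representation (rho : {linear g -> 'End(V)}) :=
  forall U W, rho (lie U W) = (rho U \o rho W)%VF - (rho W \o rho U)%VF.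

Definition form_symmetric (B : {biscalar g}) := forall U W, B U W = B W U.

Definition form_invariant (B : {biscalar g}) :=
  forall U W T, B (lie U W) T = B U (lie W T).

Definition form_nondegenerate (B : {biscalar g}) :=
  forall U, (forall W, B U W = 0) -> U = 0.

Definition fundamental_triplet (B : {biscalar g}) (rho : {linear g -> 'End(V)}) :=
  [/\ form_symmetric B, form_invariant B, form_nondegenerate B
    & is_lie_representation rho].

Variables (B : {biscalar g}) (rho : {linear g -> 'End(V)}).

(* The contragredient representation of [g] on the dual of [V]. *)
Definition corep (U : g) (Y : dual K V) : dual K V := - (Y \o rho U)%VF.

Definition form_flat (U : g) : dual K g := linfun (B U : g -> K^o).

(* The bracket of [X] (degree 1) and [Y] (degree -1), of degree 0: the element
   of [g] representing the linear form [U |-> Y (rho U X)] with respect to [B];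
   see [B_bracket_VVd]. *)
Definition bracket_VVd (X : V) (Y : dual K V) : g :=
  ((linfun form_flat)^-1)%VF (linfun (fun U => Y (rho U X))).

Definition bracket_VdV (Y : dual K V) (X : V) : g := - bracket_VVd X Y.

Definition sl2_triple (y : dual K V) (h : g) (x : V) :=
  [/\ rho h x = 2 *: x, corep h y = - 2 *: y & bracket_VdV y x = h].

Lemma form_flatE U W : form_flat U W = B U W.
Proof. by rewrite lfunE. Qed.

Lemma form_flat_is_linear : linear form_flat.
Proof.
move=> a x y; apply/lfunP => z.
by rewrite add_lfunE scale_lfunE !form_flatE linearPl.
Qed.

HB.instance Definition _ :=
  GRing.isLinear.Build K g (dual K g) _ form_flat form_flat_is_linear.

Lemma B_bracket_VVd : form_nondegenerate B ->
  forall X Y U, B (bracket_VVd X Y) U = Y (rho U X).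
Proof.
move=> Bnd X Y U; rewrite /bracket_VVd -form_flatE.
have ker0 : lker (linfun form_flat) == 0%VS.
  apply/lker0P => U1 U2; rewrite !lfunE /= => eqU.
  apply/subr0_eq/Bnd => W.
  by rewrite linearBl -!form_flatE eqU subrr.
set f := linfun form_flat; set z := (f^-1)%VF _.
have -> : form_flat z = f z by rewrite lfunE.
have lin : linear (fun U => Y (rho U X) : K^o).
  by move=> a U1 U2; rewrite linearP add_lfunE scale_lfunE linearP.
pose h := HB.pack_for {linear g -> K^o} (fun U => Y (rho U X) : K^o)
  (GRing.isLinear.Build K g K^o _ _ lin).
rewrite /z limg_lfunVK; first exact: (lfunE h).
suff -> : limg f = fullv by rewrite memvf.
apply/eqP; rewrite eqEdim subvf limg_dim_eq ?(eqP ker0) ?capv0 //.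
by rewrite !dimvf /dim /= muln1.
Qed.

Definition orbit_map (x : V) : 'Hom(g, V) := linfun (fun U => rho U x).

Definition tangent_space (x : V) : {vspace V} := limg (orbit_map x).

Lemma orbit_mapE x U : orbit_map x U = rho U x.
Proof.
have lin : linear (fun U => rho U x).
  by move=> a U1 U2; rewrite linearP add_lfunE scale_lfunE.
pose f := HB.pack_for {linear g -> V} (fun U => rho U x)
  (GRing.isLinear.Build K g V _ _ lin).
exact: (lfunE f).
Qed.

Definition annihilator (W : {vspace V}) : set (dual K V) :=
  [set y | forall v, v \in W -> y v = 0].

Definition is_class_mod (W A : set (dual K V)) :=
  exists y, A = [set y + z | z in W].

(* Restriction of linear forms; it induces the canonical isomorphism of
   V^* / W^\perp with W^*, under which the covector [xi] corresponds to the
   class [covector_class xi]. *)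
Definition restrict (W : {vspace V}) (y : dual K V) : dual K (subvs_of W) :=
  (y \o linfun vsval)%VF.

Definition covector_class (W : {vspace V}) (xi : dual K (subvs_of W)) :
  set (dual K V) := [set y | restrict W y = xi].

End Triplet.

Definition phi (K : fieldType) (g : lieAlgType K) (V : vectType K)
    (B : {biscalar g}) (rho : {linear g -> 'End(V)}) (H0 : g) (x : V) :
  set (dual K V) := [set y | sl2_triple B rho y H0 x].

(** * Linear algebraic groups *)

Section Polynomials.
Variables (K : fieldType) (E : vectType K).

(* Polynomial functions on [E], written in the coordinates of a basis. *)
Notation polyfun := {mpoly K[\dim {:E}]}.

Definition vcoord (v : E) : 'I_(\dim {:E}) -> K :=
  fun i => coord (vbasis fullv) i v.

Definition peval (p : polyfun) (v : E) : K := p.@[vcoord v].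

Definition pdiff (p : polyfun) (v w : E) : K :=
  \sum_i (p^`M(i)).@[vcoord v] * vcoord w i.

End Polynomials.

Notation polyfun K E := {mpoly K[\dim {: E%type}]}.

Section AlgebraicGroup.
Variables (K : fieldType) (n : nat).
Implicit Types (G : set 'M[K]_n) (g A : 'M[K]_n).

Definition zero_locus (S : set (polyfun K 'M[K]_n)) : set 'M[K]_n :=
  [set g | forall p, S p -> peval p g = 0].

(* Zariski-closed subgroups of GL_n; [K] is meant to be algebraically closed,
   so that a closed set is determined by its [K]-points. *)
Record algebraic_group G := AlgebraicGroup {
  algg1 : G 1%:M;
  alggM : forall g h, G g -> G h -> G (g *m h);
  alggV : forall g, G g -> G (invmx g);
  algg_closed : exists S, G = [set g | g \in unitmx] `&` zero_locus S
}.

Definition zariski_connected G :=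
  forall S T, G `<=` zero_locus S `|` zero_locus T ->
    G `&` zero_locus S `&` zero_locus T = set0 ->
    G `&` zero_locus S = set0 \/ G `&` zero_locus T = set0.

(* [f] agrees on [G] with the regular function [p / det ^+ k] of GL_n. *)
Definition represents G (f : 'M[K]_n -> K) (p : polyfun K 'M[K]_n) (k : nat) :=
  forall g, G g -> f g = peval p g / \det g ^+ k.

Definition regular_on G f := exists p k, represents G f p k.

(* The tangent space of [G] at the identity. *)
Definition tangent_at_one G : set 'M[K]_n :=
  [set A | forall p, (forall g, G g -> peval p g = 0) -> pdiff p 1%:M A = 0].

(* [c] is the derivative at 1 of the regular function [f] on [G] along the
   tangent vector [A]; recall that d(det) at 1 is the trace. *)
Definition derivative_at_one G f A (c : K) :=
  exists p k, represents G f p k /\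
    c = pdiff p 1%:M A - k%:R * peval p 1%:M * \tr A.

Record rational_representation (V : vectType K) G (pi : 'M[K]_n -> 'End(V)) :=
  RationalRepresentation {
    ratrep1 : pi 1%:M = \1%VF;
    ratrepM : forall g h, G g -> G h -> pi (g *m h) = (pi g \o pi h)%VF;
    ratrep_regular : forall (l : dual K V) v, regular_on G (fun g => l (pi g v))
  }.

(* [iota] identifies the Lie algebra [L] with that of [G]. *)
Record lie_algebra_of (L : lieAlgType K) G (iota : {linear L -> 'M[K]_n}) :=
  LieAlgebraOf {
    lieof_inj : injective iota;
    lieof_image : range iota = tangent_at_one G;
    lieof_bracket : forall U W,
      iota (lie U W) = iota U *m iota W - iota W *m iota U
  }.

(* The differential of [pi] at the identity is [rho]. *)
Definition lifts_to (L : lieAlgType K) (V : vectType K) G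
    (iota : {linear L -> 'M[K]_n}) (rho : {linear L -> 'End(V)})
    (pi : 'M[K]_n -> 'End(V)) :=
  forall (U : L) (l : dual K V) v,
    derivative_at_one G (fun g => l (pi g v)) (iota U) (l (rho U v)).

Definition group_orbit (V : vectType K) G (pi : 'M[K]_n -> 'End(V)) (x : V) : set V :=
  [set pi g x | g in G].

Definition contragredient (V : vectType K) (pi : 'M[K]_n -> 'End(V)) g
  (y : dual K V) : dual K V := (y \o pi (invmx g))%VF.

End AlgebraicGroup.

(** * The cotangent bundle of an orbit *)

Section Cotangent.
Variables (K : fieldType) (g : lieAlgType K) (V : vectType K).
Variables (rho : {linear g -> 'End(V)}) (O : set V).

(* Set-theoretic sections of T^*(O), whose fibre at x is the dual of T_x. *)
Definition cotangent_field :=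
  forall x : {x | O x}, dual K (subvs_of (tangent_space rho (sval x))).

(* Regularity in the sense of differential forms on a quasi-affine variety:
   around each point of [O] the form is \sum_i (p_i / q) dx_i restricted to the
   tangent spaces, with [x_i] the linear coordinates of [V]. *)
Definition regular_section (s : cotangent_field) :=
  forall x0 : {x | O x}, exists (q : polyfun K V) (p : 'I_(\dim {:V}) -> polyfun K V),
    peval q (sval x0) != 0 /\
    forall x : {x | O x}, peval q (sval x) != 0 ->
      s x = restrict _ (\sum_i (peval (p i) (sval x) / peval q (sval x)) *:
                          (linfun (coord (vbasis fullv) i : V -> K^o) : dual K V)).

End Cotangent.

(* Main.v *)
Require Import Defs.
From HB Require Import structures.
From mathcomp Require Import all_boot all_algebra.
From mathcomp Require Import classical_sets reals complex mpoly.
From mathcomp Require Import fingroup perm ssrnum ring.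

Set Implicit Arguments.
Unset Strict Implicit.
Unset Printing Implicit Defensive.

Import GRing.Theory Num.Theory.
Local Open Scope classical_set_scope.
Local Open Scope ring_scope.

(** Write [b U = - B0 (H0, U)].  Since [rho H0 = 2 Id], the first two equations
    of an sl_2-triple [(y, H0, x)] hold for all [x] and [y], and the third one,
    paired with [B0], says that [y (rho U x) = b U] for all [U] ([phiE]).  So
    [phi x] is the set of the extensions to [V] of one linear form on
    [T_x = g0.x], namely [rho U x |-> b U].  It is a class modulo the
    annihilator of [T_x] as soon as this form is well defined, that is, as soon
    as [b] vanishes on the stabilizer of [x].

    At [X] this is the hypothesis on [X] ([stabilizer_orthogonal]): if
    [U = c H0 + D], with [D] in the derived algebra, kills [X], then
    [2 c X = - rho D X], hence [c = 0], and [b D = 0] because the center is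
    orthogonal to the derived algebra.

    The group carries this to the rest of the orbit.  The adjoint action is
    conjugation in the tangent space of [G0] at the identity, and
    differentiating [pi (g h g^-1) = pi g pi h pi g^-1] in [h] gives
    [rho (Ad g U) = pi g rho(U) pi g^-1] ([rho_Ad]).  As differentials of
    representations are specified through some expression [p / det^k] of the
    matrix coefficients, this needs the uniqueness of the derivative of a
    regular function along a tangent vector ([derivative_at_one_unique]), hence
    the differential of the determinant at the identity.  Now [Ad g] is an
    automorphism, so it preserves the derived algebra and the center; on the
    latter, which is the line of [H0], it is the identity because
    [rho (Ad g H0) = 2 Id].  Therefore [b] is invariant under [Ad g]
    ([central_form_Ad]), which yields both the condition on stabilizers along
    the orbit and the equivariance of [phi] ([phi_contragredient]).

    Regularity of the section is Cramer's rule ([covector_section_regular]).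
    Near [x0], choose [U_j] such that the [rho U_j x0] form a basis of [T_x0].
    As [dim T_x] is constant on the orbit, the [rho U_j x] remain a basis of
    [T_x] where a determinant that is polynomial in [x] does not vanish, and
    there a form with [y (rho U_j x) = b U_j] is obtained by solving a linear
    system whose coefficients are polynomial in [x]. *)

(** * Differential calculus of polynomial functions *)

Section PolynomialFunctions.
Variables (K : fieldType) (E : vectType K).
Implicit Types (p q : polyfun K E) (v w : E) (l : dual K E).

Lemma pdiffD p q v w : pdiff (p + q) v w = pdiff p v w + pdiff q v w.
Proof.
by rewrite -big_split; apply: eq_bigr => i _ /=; rewrite mderivD mevalD mulrDl.
Qed.

Lemma pdiffN p v w : pdiff (- p) v w = - pdiff p v w.
Proof.
by rewrite -sumrN; apply: eq_bigr => i _; rewrite mderivN mevalN mulNr.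
Qed.

Lemma pdiffZ c p v w : pdiff (c *: p) v w = c * pdiff p v w.
Proof.
by rewrite mulr_sumr; apply: eq_bigr => i _; rewrite mderivZ mevalZ mulrA.
Qed.

Lemma pdiffC c v w : pdiff c%:MP v w = 0.
Proof. by apply: big1 => i _; rewrite mderivC meval0 mul0r. Qed.

Lemma pdiffM p q v w :
  pdiff (p * q) v w = pdiff p v w * peval q v + peval p v * pdiff q v w.
Proof.
rewrite mulr_suml mulr_sumr -big_split; apply: eq_bigr => i _ /=.
by rewrite mderivM mevalD !mevalM /peval; ring.
Qed.

Lemma pdiff_sum I r (P : pred I) (F : I -> polyfun K E) v w :
  pdiff (\sum_(i <- r | P i) F i) v w = \sum_(i <- r | P i) pdiff (F i) v w.
Proof.
apply: (big_morph (fun p => pdiff p v w)) => [p q|]; first exact: pdiffD.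
by rewrite -mpolyC0 pdiffC.
Qed.

Lemma pdiffX p k v w :
  pdiff (p ^+ k) v w = k%:R * peval p v ^+ k.-1 * pdiff p v w.
Proof.
case: k => [|k]; first by rewrite expr0 -mpolyC1 pdiffC !mul0r.
elim: k => [|k IH]; first by rewrite expr1 expr0 !mul1r.
rewrite exprS pdiffM IH /= /peval rmorphXn /= exprS; ring.
Qed.

Definition coord_form i : dual K E := linfun (coord (vbasis fullv) i : E -> K^o).

Lemma coord_formE i v : coord_form i v = coord (vbasis fullv) i v.
Proof. exact: lfunE. Qed.

Definition linear_poly l : polyfun K E :=
  \sum_(i < \dim {:E}) l (vbasis fullv)`_i *: 'X_i.

Lemma peval_linear l v : peval (linear_poly l) v = l v.
Proof.
rewrite /peval raddf_sum [in RHS](coord_vbasis (memvf v)) linear_sum.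
by apply: eq_bigr => i _; rewrite /= /peval mevalZ mevalXU linearZ /= mulrC.
Qed.

Lemma pdiff_coord i v w : pdiff ('X_i : polyfun K E) v w = coord_form i w.
Proof.
rewrite /pdiff (bigD1 i) //= big1 => [|j ji]; rewrite mderivX mnm1E.
  rewrite eqxx scale1r -{1}[U_(i)%MM]add0m addmK mpolyX0 meval1.
  by rewrite mul1r addr0 coord_formE.
by rewrite eq_sym (negPf ji) scale0r meval0 mul0r.
Qed.

Lemma pdiff_linear l v w : pdiff (linear_poly l) v w = l w.
Proof.
rewrite pdiff_sum [in RHS](coord_vbasis (memvf w)) linear_sum.
apply: eq_bigr => i _.
by rewrite pdiffZ pdiff_coord coord_formE linearZ /= mulrC.
Qed.

Lemma pdiff_prod (I : eqType) (r : seq I) (F : I -> polyfun K E) v w :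
  uniq r ->
  pdiff (\prod_(i <- r) F i) v w =
  \sum_(i <- r) pdiff (F i) v w * \prod_(j <- r | j != i) peval (F j) v.
Proof.
elim: r => [|a r IH] /=; first by rewrite !big_nil -mpolyC1 pdiffC.
case/andP=> ar /IH{}IH; rewrite !big_cons pdiffM IH eqxx /=; congr (_ * _ + _).
  rewrite /peval rmorph_prod [RHS]big_mkcond; apply: eq_big_seq => j jr /=.
  by case: eqP => // ja; rewrite ja (negPf ar) in jr.
rewrite mulr_sumr; apply: eq_big_seq => i ir; rewrite big_cons.
by case: eqP => [ai|_]; [rewrite -ai (negPf ar) in ir | rewrite mulrCA].
Qed.

Lemma dual_separates v : (forall l, l v = 0) -> v = 0.
Proof.
move=> v0; rewrite (coord_vbasis (memvf v)) big1 // => i _.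
by rewrite -coord_formE v0 scale0r.
Qed.

Lemma peval_det m (M : 'M[polyfun K E]_m) v :
  peval (\det M) v = \det (map_mx (fun p => peval p v) M).
Proof. by rewrite /peval -det_map_mx. Qed.

End PolynomialFunctions.

Arguments coord_form {K} E i.

Section Substitution.
Variables (K : fieldType) (E F : vectType K) (f : 'Hom(E, F)).
Implicit Types (p : polyfun K F) (v w : E).

Definition pullback p : polyfun K E :=
  p \mPo [tuple linear_poly (coord_form F i \o f)%VF | i < \dim {:F}].

Lemma peval_pullback p v : peval (pullback p) v = peval p (f v).
Proof.
rewrite /peval /pullback comp_mpoly_meval; apply: meval_eq => i.
by rewrite tnth_mktuple -/(peval _ _) peval_linear comp_lfunE coord_formE.
Qed.

(** Chain rule: both sides satisfy the Leibniz rule, so it is enough to compare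
    them on the coordinates of [F]. *)
Lemma pdiff_pullback p v w : pdiff (pullback p) v w = pdiff p (f v) (f w).
Proof.
set P := (fun p => pdiff (pullback p) v w = pdiff p (f v) (f w)); rewrite -/(P p).
have PM q r : P q -> P r -> P (q * r).
  rewrite /P /pullback rmorphM !pdiffM -!/(pullback _) !peval_pullback.
  by move=> -> ->.
have P1 : P 1 by rewrite /P /pullback comp_mpoly1 -mpolyC1 !pdiffC.
have PX i : P 'X_i.
  rewrite /P /pullback comp_mpolyXU -tnth_nth tnth_mktuple pdiff_linear.
  by rewrite comp_lfunE pdiff_coord.
elim/mpolyind: p => [|c m p _ _ IH].
  by rewrite /P /pullback comp_mpoly0 -mpolyC0 -[in RHS]mpolyC0 !pdiffC.
rewrite /P /pullback comp_mpolyD comp_mpolyZ !pdiffD !pdiffZ -!/(pullback _) IH.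
congr (_ * _ + _); rewrite -/(P _) mpolyXE_id.
elim/big_ind: _ => // i _; elim: (m i) => [|k IHk]; rewrite ?expr0 // exprS.
exact: PM.
Qed.

End Substitution.

(** * The general linear group *)

Section GeneralLinear.
Variables (K : fieldType) (n : nat).
Implicit Types (A : 'M[K]_n).

Definition entry_form (i j : 'I_n) : dual K 'M[K]_n := linfun (fun A => A i j : K^o).

Lemma entry_formE i j A : entry_form i j A = A i j.
Proof.
have lin : linear (fun A => A i j : K^o) by move=> a A1 A2; rewrite !mxE.
pose f := HB.pack_for {linear 'M[K]_n -> K^o} (fun A => A i j : K^o)
  (GRing.isLinear.Build K 'M[K]_n K^o _ _ lin).
exact: (lfunE f).
Qed.

Definition det_poly : polyfun K 'M[K]_n :=
  \det (\matrix_(i, j) linear_poly (entry_form i j)).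

Lemma peval_det_poly A : peval det_poly A = \det A.
Proof.
rewrite peval_det; congr (\det _); apply/matrixP => i j.
by rewrite !mxE peval_linear entry_formE.
Qed.

(** In the Leibniz expansion, a permutation other than the identity moves at
    least two indices, so each term of the product rule keeps an off-diagonal
    entry of the identity matrix as a factor. *)
Lemma pdiff_det_poly A : pdiff det_poly 1%:M A = \tr A.
Proof.
rewrite /det_poly /determinant pdiff_sum (bigD1 (1%g : 'S_n)) //=.
rewrite [X in _ + X]big1 ?addr0 => [|s s1].
  rewrite odd_perm1 mul1r pdiff_prod ?index_enum_uniq //.
  apply: eq_bigr => i _; rewrite mxE perm1 pdiff_linear entry_formE.
  rewrite big1 ?mulr1 // => j _.
  by rewrite mxE peval_linear entry_formE mxE perm1 eqxx.
rewrite -(rmorph_sign (@mpolyC _ K)) mul_mpolyC pdiffZ pdiff_prod ?index_enum_uniq //.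
rewrite big1 ?mulr0 // => i _.
have [j ji sj] : exists2 j, j != i & s j != j.
  have /existsP[j sj] : [exists j, s j != j].
    rewrite -negb_forall; apply: contra s1 => /forallP s1.
    by apply/eqP/permP => k; rewrite perm1; apply/eqP.
  have [ji|] := eqVneq j i; last by exists j.
  by exists (s j); [rewrite -ji | rewrite (inj_eq perm_inj)].
rewrite (bigD1 j) //= !mxE peval_linear entry_formE mxE eq_sym (negPf sj).
by rewrite mul0r mulr0.
Qed.

Definition conj_lin (g : 'M[K]_n) : 'End('M[K]_n) :=
  linfun (mulmxr (invmx g) \o mulmx g).

Lemma conj_linE g A : conj_lin g A = g *m A *m invmx g.
Proof. by rewrite lfunE. Qed.

End GeneralLinear.

(** * Derivatives at the identity of an algebraic group *)

Section AlgebraicGroups.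
Variables (K : fieldType) (n : nat) (G : set 'M[K]_n) (G_group : algebraic_group G).
Implicit Types (g h A : 'M[K]_n) (f : 'M[K]_n -> K).

Lemma algg_unit g : G g -> g \in unitmx.
Proof. by have [S ->] := algg_closed G_group; case. Qed.

Lemma algg_conj g h : G g -> G h -> G (conj_lin g h).
Proof.
move=> Gg Gh; rewrite conj_linE; do !apply: (alggM G_group) => //.
exact: (alggV G_group).
Qed.

Lemma conj_lin1 g : G g -> conj_lin g 1%:M = 1%:M.
Proof. by move=> Gg; rewrite conj_linE mulmx1 mulmxV ?algg_unit. Qed.

(** Composing with conjugation by [g], which fixes the identity, preserves the
    polynomials that vanish on [G]. *)
Lemma tangent_conj g A :
  G g -> tangent_at_one G A -> tangent_at_one G (conj_lin g A).
Proof.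
move=> Gg TA p p0; rewrite -(conj_lin1 Gg) -pdiff_pullback.
by apply: TA => h Gh; rewrite peval_pullback p0 //; apply: algg_conj.
Qed.

(** If [p / det^k = q / det^m] on [G], then [p det^m - q det^k] vanishes on [G],
    so its differential at the identity vanishes on tangent vectors; this is
    the equality of the two derivatives, as [p] and [q] agree at the
    identity. *)
Lemma derivative_at_one_unique f A c d : tangent_at_one G A ->
  derivative_at_one G f A c -> derivative_at_one G f A d -> c = d.
Proof.
move=> TA [p [k [fp ->]]] [q [m [fq ->]]].
have p1q1 : peval p 1%:M = peval q 1%:M.
  have := fp _ (algg1 G_group); rewrite (fq _ (algg1 G_group)).
  by rewrite !det1 !expr1n !divr1.
have := TA (p * det_poly K n ^+ m - q * det_poly K n ^+ k).
have detX j g : peval (det_poly K n ^+ j) g = \det g ^+ j.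
  by rewrite /peval rmorphXn /= -/(peval _ _) peval_det_poly.
rewrite pdiffD pdiffN !pdiffM !pdiffX !detX !peval_det_poly pdiff_det_poly.
rewrite !det1 !expr1n -p1q1 => pq.
suff /pq pq0 : forall g, G g ->
    peval (p * det_poly K n ^+ m - q * det_poly K n ^+ k) g = 0.
  by apply: subr0_eq; rewrite -[RHS]pq0; ring.
move=> g Gg.
have det_neq0 : \det g != 0 by have := algg_unit Gg; rewrite unitmxE unitfE.
have := fp g Gg; rewrite fq // => /eqP.
rewrite eqr_div ?expf_neq0 // => /eqP eq_pq.
by rewrite /peval mevalB !mevalM -!/(peval _ _) !detX eq_pq subrr.
Qed.

(** Conjugation changes neither the determinant nor the trace, so the same
    exponent of the determinant serves for [f] and for its conjugate. *)
Lemma derivative_at_one_conj f g A c : G g ->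
  derivative_at_one G f (conj_lin g A) c ->
  derivative_at_one G (fun h => f (conj_lin g h)) A c.
Proof.
move=> Gg [p [k [fp ->]]]; exists (pullback (conj_lin g) p), k; split.
  move=> h Gh; rewrite fp; last exact: algg_conj.
  rewrite peval_pullback conj_linE !det_mulmx det_inv.
  by rewrite mulrAC divff ?mul1r // -unitfE -unitmxE algg_unit.
rewrite pdiff_pullback peval_pullback conj_lin1 // conj_linE.
by rewrite -mulmxA mxtrace_mulC -mulmxA mulVmx ?algg_unit // mulmx1.
Qed.

End AlgebraicGroups.

(** * The adjoint action *)

Lemma lie_derived_sub (K : fieldType) (L : lieAlgType K) (W : {vspace L}) :
  (forall u v, lie u v \in W) -> (lie_derived L <= W)%VS.
Proof.
by move=> lieW; apply/span_subvP => _ /allpairsP[[u v] /= [_ _ ->]]; apply: lieW.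
Qed.

Section Adjoint.
Variables (K : fieldType) (L : lieAlgType K) (n : nat) (G : set 'M[K]_n).
Variables (iota : {linear L -> 'M[K]_n}).
Hypotheses (G_group : algebraic_group G) (G_Lie : lie_algebra_of G iota).

(** Conjugation read through [iota], whose image is stable under it when [g]
    lies in [G]; see [iota_Ad]. *)
Definition Ad (g : 'M[K]_n) : 'End(L) :=
  ((linfun iota)^-1 \o conj_lin g \o linfun iota)%VF.

Lemma iota_tangent U : tangent_at_one G (iota U).
Proof. by rewrite -(lieof_image G_Lie); exists U. Qed.

Lemma iota_Ad g U : G g -> iota (Ad g U) = conj_lin g (iota U).
Proof.
move=> Gg; have := tangent_conj G_group Gg (iota_tangent U).
rewrite -(lieof_image G_Lie) => -[W _ eqW].
rewrite !comp_lfunE (lfunE iota) /= -eqW; apply: (congr1 iota).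
rewrite -[X in (_^-1)%VF X](lfunE iota) lker0_lfunK //; apply/lker0P => x y.
by rewrite !lfunE; apply: (lieof_inj G_Lie).
Qed.

Lemma AdK g U : G g -> Ad g (Ad (invmx g) U) = U.
Proof.
move=> Gg; apply: (lieof_inj G_Lie); have Gg' := alggV G_group Gg.
rewrite !iota_Ad // !conj_linE invmxK !mulmxA mulmxV ?(algg_unit G_group) //.
by rewrite mul1mx mulmxK // (algg_unit G_group).
Qed.

Lemma Ad_lie g U W : G g -> Ad g (lie U W) = lie (Ad g U) (Ad g W).
Proof.
move=> Gg; apply: (lieof_inj G_Lie).
rewrite (lieof_bracket G_Lie) !iota_Ad // (lieof_bracket G_Lie) linearB /= !conj_linE.
by rewrite !mulmxA !(mulmxKV (algg_unit G_group Gg)).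
Qed.

Lemma Ad_center g U : G g -> U \in lie_center L -> Ad g U \in lie_center L.
Proof.
move=> Gg /lie_centerP U0; apply/lie_centerP => W.
by rewrite -(AdK W Gg) -Ad_lie // U0 linear0.
Qed.

Lemma Ad_derived g U : G g -> U \in lie_derived L -> Ad g U \in lie_derived L.
Proof.
move=> Gg; rewrite memv_preim; apply/subvP: U; apply: lie_derived_sub => u v.
by rewrite -memv_preim Ad_lie // mem_lie_prod ?memvf.
Qed.

Section Representation.
Variables (V : vectType K) (rho : {linear L -> 'End(V)}) (pi : 'M[K]_n -> 'End(V)).
Hypotheses (pi_rep : rational_representation G pi) (pi_lift : lifts_to G iota rho pi).

Lemma ratrepV g : G g -> (pi g \o pi (invmx g))%VF = \1%VF.
Proof.
move=> Gg; rewrite -(ratrepM pi_rep) //; last exact: (alggV G_group).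
rewrite mulmxV ?(ratrep1 pi_rep) //; exact: (algg_unit G_group).
Qed.

(** Both sides are the derivative at the identity, along [iota U], of the same
    matrix coefficient: [h |-> l (pi (g h g^-1) v)] for the left-hand side,
    [h |-> (l o pi g) (pi h (pi g^-1 v))] for the right-hand side. *)
Lemma rho_Ad g U : G g -> rho (Ad g U) = (pi g \o rho U \o pi (invmx g))%VF.
Proof.
move=> Gg; have Gg' := alggV G_group Gg; apply/lfunP => v.
apply/subr0_eq/dual_separates => l; rewrite linearB /=.
apply/eqP; rewrite subr_eq0; apply/eqP.
apply: (derivative_at_one_unique G_group (iota_tangent U)).
  apply: (derivative_at_one_conj G_group Gg); rewrite -iota_Ad //; exact: pi_lift.
have [p [k [lp eq_p]]] := pi_lift U (l \o pi g)%VF (pi (invmx g) v).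
exists p, k; split; last by rewrite -eq_p !comp_lfunE.
move=> h Gh; rewrite -lp // comp_lfunE conj_linE.
rewrite (ratrepM pi_rep) ?(ratrepM pi_rep) ?comp_lfunE //; exact: (alggM G_group).
Qed.

End Representation.
End Adjoint.

(** * Cotangent fields given by a linear form on the Lie algebra *)

Section Covectors.
Variables (K : fieldType) (L : lieAlgType K) (V : vectType K).
Variables (rho : {linear L -> 'End(V)}).
Implicit Types (x : V) (y : dual K V) (b : dual K L) (W : {vspace V}).

Lemma restrictP W y y' :
  Defs.restrict W y = Defs.restrict W y' <-> (forall v, v \in W -> y v = y' v).
Proof.
split=> [eqW v Wv | eqW].
  have := congr1 (fun f : dual K (subvs_of W) => f (vsproj W v)) eqW.
  by rewrite !comp_lfunE !lfunE /= vsprojK.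
by apply/lfunP => u; rewrite !comp_lfunE !lfunE /= eqW ?subvsP.
Qed.

(** The linear form [rho U x |-> b U] on the tangent space, extended to [V] by
    means of a partial inverse of the orbit map; it is well defined when [b]
    vanishes on the stabilizer of [x]. *)
Definition covector b x : dual K V := (b \o (orbit_map rho x)^-1)%VF.

Lemma tangentP x v : reflect (exists U, v = rho U x) (v \in tangent_space rho x).
Proof.
apply: (iffP memv_imgP) => [[U _ ->] | [U ->]]; exists U; rewrite ?memvf //.
  exact: orbit_mapE.
by rewrite orbit_mapE.
Qed.

Lemma mem_tangent x U : rho U x \in tangent_space rho x.
Proof. by apply/tangentP; exists U. Qed.

Lemma covectorE b x U :
  (forall U', rho U' x = 0 -> b U' = 0) -> covector b x (rho U x) = b U.
Proof.
move=> b0; rewrite comp_lfunE; apply/subr0_eq; rewrite -linearB; apply: b0.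
rewrite -orbit_mapE linearB /= -(orbit_mapE rho x U).
by rewrite limg_lfunVK ?subrr // memv_img ?memvf.
Qed.

Lemma linear_poly_orbit (l : dual K V) U x :
  peval (linear_poly (l \o rho U)%VF) x = l (rho U x).
Proof. by rewrite peval_linear comp_lfunE. Qed.

(** With [l_k] the coordinate forms on the tangent space at [x0], and with [U_j]
    such that the [rho U_j x0] are its basis, the matrix [N] of entries
    [l_k (rho U_j x)] is linear in [x] and is the identity at [x0].  Where it is
    invertible, the [rho U_j x] are free, hence a basis of the tangent space
    since the dimension is constant, and [sum_k (N^-1 b)_k l_k] is the required
    form; the adjugate of [N] makes its coefficients fractions with denominator
    [det N]. *)
Lemma covector_section_regular (O : set V) b :
  (forall x x', O x -> O x' ->
     \dim (tangent_space rho x) = \dim (tangent_space rho x')) ->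
  (forall x, O x -> forall U, rho U x = 0 -> b U = 0) ->
  regular_section (fun x : {x | O x} =>
    Defs.restrict (tangent_space rho (sval x)) (covector b (sval x))).
Proof.
move=> dimT b0 [x0 Ox0] /=; set T0 := tangent_space rho x0.
pose l (k : 'I_(\dim T0)) : dual K V := linfun (coord (vbasis T0) k : V -> K^o).
pose U (j : 'I_(\dim T0)) := ((orbit_map rho x0)^-1 (vbasis T0)`_j)%VF.
have UE j : rho (U j) x0 = (vbasis T0)`_j.
  by rewrite -orbit_mapE limg_lfunVK // vbasis_mem ?mem_nth ?size_tuple.
pose N := \matrix_(j, k) linear_poly (l k \o rho (U j))%VF.
pose bU := \col_j b (U j).
pose Nx x := \matrix_(j, k) l k (rho (U j) x).
have evN x : map_mx (meval (vcoord x)) N = Nx x.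
  by apply/matrixP => j k; rewrite !mxE -/(peval _ _) linear_poly_orbit.
have qE x : peval (\det N) x = \det (Nx x) by rewrite /peval -evN det_map_mx.
(* The coefficient of the coordinate [x_i] in [sum_k (adj N b)_k l_k]. *)
pose p i : polyfun K V :=
  \sum_k (\adj N *m map_mx (@mpolyC _ K) bU) k 0 * (l k (vbasis fullv)`_i)%:MP.
have pE i x : peval (p i) x =
    \sum_k (\adj (Nx x) *m bU) k 0 * l k (vbasis fullv)`_i.
  rewrite /peval rmorph_sum; apply: eq_bigr => k _; rewrite rmorphM /= mevalC.
  congr (_ * _); rewrite -evN -map_mx_adj.
  have -> : bU = map_mx (meval (vcoord x)) (map_mx (@mpolyC _ K) bU).
    by apply/matrixP => j j'; rewrite !mxE mevalC.
  rewrite -map_mxM !mxE; congr (meval _ _); apply: eq_bigr => j _.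
  by rewrite !mxE mevalC.
exists (\det N), p; split.
  rewrite qE (_ : Nx x0 = 1%:M) ?det1 ?oner_eq0 //; apply/matrixP => j k.
  by rewrite !mxE UE lfunE /= coord_free 1?eq_sym // (basis_free (vbasisP _)).
case=> x Ox /=; rewrite qE => q0; apply/restrictP => v.
pose X := [tuple rho (U j) x | j < \dim T0].
have XE (j : 'I__) : X`_j = rho (U j) x by rewrite -tnth_nth tnth_mktuple.
have Nunit : Nx x \in unitmx by rewrite unitmxE unitfE.
have freeX : free X.
  apply/freeP => c c0 j.
  suff /rowP/(_ j) : \row_j c j = 0 by rewrite !mxE.
  rewrite -[LHS](mulmxK Nunit) (_ : _ *m Nx x = 0) ?mul0mx //.
  apply/rowP => k; rewrite !mxE -[RHS](linear0 (l k)) -c0 linear_sum.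
  by apply: eq_bigr => i _; rewrite !mxE linearZ XE.
have -> : tangent_space rho x = <<X>>%VS.
  apply/esym/eqP; rewrite eqEdim (eqnP freeX) size_tuple.
  rewrite (dimT _ _ Ox Ox0) leqnn andbT; apply/span_subvP => u /tnthP[j ->].
  by rewrite tnth_mktuple mem_tangent.
move=> /coord_span ->; rewrite !linear_sum; apply: eq_bigr => j _.
rewrite !linearZ /=; congr (_ * _); rewrite XE covectorE; last exact: b0.
transitivity (\sum_k (\adj (Nx x) *m bU) k 0 / \det (Nx x) * l k (rho (U j) x)).
  have : Nx x *m (\adj (Nx x) *m bU) = \det (Nx x) *: bU.
    by rewrite mulmxA mul_mx_adj mul_scalar_mx.
  move/colP/(_ j); rewrite !mxE => eqb.
  rewrite -[LHS](mulKf q0) -eqb mulr_sumr; apply: eq_bigr => k _.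
  by rewrite [Nx x j k]mxE; ring.
rewrite sum_lfunE; under eq_bigr => k _ do
  rewrite [X in l k X](coord_vbasis (memvf _)) linear_sum mulr_sumr.
rewrite exchange_big; apply: eq_bigr => i _; rewrite scale_lfunE coord_formE pE.
rewrite [RHS]mulrAC mulr_suml [RHS]mulr_suml; apply: eq_bigr => k _ /=; rewrite linearZ.
by rewrite /= /GRing.scale /=; ring.
Qed.

End Covectors.

(** * Fundamental triplets with one-dimensional center *)

Section Triplets.
Variables (K : fieldType) (L : lieAlgType K) (V : vectType K).
Variables (B : {biscalar L}) (rho : {linear L -> 'End(V)}) (H0 : L).
Hypotheses (two_neq0 : 2 != 0 :> K) (triplet : fundamental_triplet B rho).
Hypotheses (L_reductive : lie_reductive L) (dim_center : \dim (lie_center L) = 1%N).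
Hypotheses (H0_center : H0 \in lie_center L) (rho_H0 : rho H0 = 2 *: \1%VF).
Implicit Types (x : V) (y : dual K V).

(** The sign is that of [bracket_VdV Y X = - bracket_VVd X Y]. *)
Definition central_form : dual K L := - form_flat B H0.

Lemma central_formE U : central_form U = - B H0 U.
Proof. by rewrite opp_lfunE form_flatE. Qed.

(** The first two equations of the triple are automatic because
    [rho H0 = 2 Id]; the third is tested against all [U] with the
    non-degenerate form. *)
Lemma phiE x y : phi B rho H0 x y <-> forall U, y (rho U x) = central_form U.
Proof.
have [_ _ Bnd _] := triplet; split=> [[_ _ yx] U | yx].
  by rewrite central_formE -yx /bracket_VdV linearNl opprK B_bracket_VVd.
split.
- by rewrite rho_H0 scale_lfunE id_lfunE.
- apply/lfunP => v; rewrite /corep opp_lfunE comp_lfunE rho_H0.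
  by rewrite !scale_lfunE id_lfunE linearZ scaleNr.
- apply/subr0_eq/Bnd => U; rewrite /bracket_VdV linearBl linearNl.
  by rewrite B_bracket_VVd // yx central_formE opprK subrr.
Qed.

(** By invariance, [B (Z, [U, W]) = B ([Z, U], W) = 0]. *)
Lemma center_derived_orthogonal Z D :
  Z \in lie_center L -> D \in lie_derived L -> B Z D = 0.
Proof.
have [_ Binv _ _] := triplet; move=> /lie_centerP Z0 D'.
have /subvP/(_ D D') : (lie_derived L <= lker (form_flat B Z))%VS.
  by apply: lie_derived_sub => U W; rewrite memv_ker form_flatE -Binv Z0 linear0l.
by rewrite memv_ker form_flatE => /eqP.
Qed.

Section Nonzero.
Variables (x : V) (x_neq0 : x != 0).

(** [H0] does not vanish, since it acts on [x] as multiplication by 2. *)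
Lemma center_line : lie_center L = <[H0]>%VS.
Proof.
apply/esym/eqP; rewrite eqEdim -memvE H0_center dim_center dim_vline.
case: eqP => // H0_0; case/eqP: x_neq0; apply: (scalerI two_neq0).
have := congr1 (fun f : 'End(V) => f x) rho_H0.
by rewrite H0_0 linear0 scale_lfunE zero_lfunE id_lfunE scaler0.
Qed.

Lemma center_derived_decomp U :
  exists c, exists2 D, D \in lie_derived L & U = c *: H0 + D.
Proof.
have [sumL _ _] := L_reductive; have : U \in fullv by rewrite memvf.
rewrite -sumL center_line => /memv_addP[_ /vlineP[c ->] [D LD ->]].
by exists c, D.
Qed.

End Nonzero.

(** If [U = c H0 + D] kills [x] then [2 c x = - rho D x], so [c = 0] unless [x]
    is tangent to its orbit under the derived algebra. *)
Lemma stabilizer_orthogonal x :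
  x \notin (orbit_map rho x @: lie_derived L)%VS ->
  forall U, rho U x = 0 -> central_form U = 0.
Proof.
move=> x_notin U.
have x_neq0 : x != 0 by apply: contraNneq x_notin => ->; rewrite mem0v.
have [c [D LD ->]] := center_derived_decomp x_neq0 U.
rewrite linearD add_lfunE linearZ scale_lfunE rho_H0 scale_lfunE id_lfunE => eq0.
have [-> | c_neq0] := eqVneq c 0.
  by rewrite scale0r add0r central_formE center_derived_orthogonal ?oppr0.
case/negP: x_notin; apply/memv_imgP; exists ((- (c * 2))^-1 *: D); first exact: memvZ.
have c2_neq0 : - (c * 2) != 0 by rewrite oppr_eq0 mulf_neq0.
rewrite linearZ /= orbit_mapE; apply: (scalerI c2_neq0).
rewrite scalerA mulfV // scale1r scaleNr -scalerA.
by move/eqP: eq0; rewrite addr_eq0 => /eqP ->; rewrite opprK.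
Qed.

Section Group.
Variables (n : nat) (G : set 'M[K]_n) (iota : {linear L -> 'M[K]_n}).
Variables (pi : 'M[K]_n -> 'End(V)).
Hypotheses (G_group : algebraic_group G) (G_Lie : lie_algebra_of G iota).
Hypotheses (pi_rep : rational_representation G pi) (pi_lift : lifts_to G iota rho pi).

Lemma piKV g x : G g -> pi g (pi (invmx g) x) = x.
Proof.
by move=> Gg; rewrite -comp_lfunE (ratrepV G_group pi_rep Gg) id_lfunE.
Qed.

Lemma piK g x : G g -> pi (invmx g) (pi g x) = x.
Proof. by move=> Gg; have := piKV x (alggV G_group Gg); rewrite invmxK. Qed.

(** [Ad g H0] is central, hence a multiple of [H0], and it acts on [V] as a
    conjugate of [2 Id]. *)
Lemma Ad_H0 g x : x != 0 -> G g -> Ad iota g H0 = H0.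
Proof.
move=> x_neq0 Gg; have := Ad_center G_group G_Lie Gg H0_center.
rewrite (center_line x_neq0) => /vlineP[a AdH0]; rewrite AdH0.
suff /eqP : (a * 2 - 2) *: x = 0.
  rewrite scaler_eq0 (negPf x_neq0) orbF -[X in _ - X]mul1r -mulrBl mulf_eq0.
  by rewrite (negPf two_neq0) orbF subr_eq0 => /eqP ->; rewrite scale1r.
have := rho_Ad G_group G_Lie pi_rep pi_lift H0 Gg.
move=> /(congr1 (fun f : 'End(V) => f x)).
rewrite AdH0 linearZ rho_H0 !comp_lfunE !scale_lfunE !id_lfunE !linearZ /= piKV //.
by rewrite scalerA scalerBl mulrC => ->; rewrite subrr.
Qed.

Lemma central_form_Ad g x U : x != 0 -> G g ->
  central_form (Ad iota g U) = central_form U.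
Proof.
move=> x_neq0 Gg; have [c [D LD ->]] := center_derived_decomp x_neq0 U.
have -> : Ad iota g (c *: H0 + D) = c *: H0 + Ad iota g D.
  by rewrite linearD linearZ /= (Ad_H0 x_neq0 Gg).
rewrite !(linearD central_form) /=; congr (_ + _); rewrite !central_formE.
by rewrite !center_derived_orthogonal //; apply: (Ad_derived G_group G_Lie Gg).
Qed.

(** Hence the tangent space at [pi g x] lies in the image under [pi g] of the
    one at [x]. *)
Lemma rho_pi g x U : G g ->
  rho U (pi g x) = pi g (rho (Ad iota (invmx g) U) x).
Proof.
move=> Gg; have Gg' := alggV G_group Gg.
rewrite (rho_Ad G_group G_Lie pi_rep pi_lift U Gg') invmxK !comp_lfunE.
by rewrite piKV.
Qed.

Lemma dim_tangent_pi g x : G g ->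
  \dim (tangent_space rho (pi g x)) = \dim (tangent_space rho x).
Proof.
have le_dim h v : G h ->
    (\dim (tangent_space rho (pi h v)) <= \dim (tangent_space rho v))%N.
  move=> Gh; apply: (@leq_trans (\dim (pi h @: tangent_space rho v))).
    apply/dimvS/subvP => _ /tangentP[U ->].
    by rewrite rho_pi // memv_img // mem_tangent.
  by rewrite -[leqRHS](limg_ker_dim (pi h)) leq_addl.
move=> Gg; apply/eqP; rewrite eqn_leq le_dim // -{1}(piK x Gg) le_dim //.
exact: (alggV G_group).
Qed.

Lemma phi_contragredient g x y : x != 0 -> G g ->
  phi B rho H0 x y -> phi B rho H0 (pi g x) (contragredient pi g y).
Proof.
move=> x_neq0 Gg /phiE yx; apply/phiE => U; rewrite comp_lfunE rho_pi // piK //.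
by rewrite yx (central_form_Ad _ x_neq0) //; apply: (alggV G_group).
Qed.

End Group.
End Triplets.

(** * The equivariant section over the orbit *)

Theorem proposition4p2p7 (R : realType) (g0 : lieAlgType R[i]) (V : vectType R[i])
    (B0 : {biscalar g0}) (rho : {linear g0 -> 'End(V)})
    (triplet : fundamental_triplet B0 rho)
    (reductive : lie_reductive g0)
    (dim_center : \dim (lie_center g0) = 1%N)
    (rho_center : (linfun rho @: lie_center g0)%VS = <[\1%VF : 'End(V)]>%VS)
    (n : nat) (G0 : set 'M[R[i]]_n)
    (G0_group : algebraic_group G0) (G0_connected : zariski_connected G0)
    (iota : {linear g0 -> 'M[R[i]]_n}) (G0_Lie : lie_algebra_of G0 iota)
    (pi : 'M[R[i]]_n -> 'End(V))
    (pi_rep : rational_representation G0 pi)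
    (pi_lift : lifts_to G0 iota rho pi)
    (H0 : g0) (H0_center : H0 \in lie_center g0)
    (rho_H0 : rho H0 = 2 *: \1%VF)
    (X : V) (X_notin : X \notin (orbit_map rho X @: lie_derived g0)%VS) :
  let OX := group_orbit G0 pi X in
  [/\ forall x, OX x ->
        is_class_mod (annihilator (tangent_space rho x)) (phi B0 rho H0 x),
      exists s : cotangent_field rho OX,
        regular_section s /\
        forall x : {x | OX x}, phi B0 rho H0 (sval x) = covector_class (s x)
    & forall g x, G0 g -> OX x ->
        phi B0 rho H0 (pi g x) =
          [set contragredient pi g y | y in phi B0 rho H0 x]].
Proof.
move=> OX; have two_neq0 : 2 != 0 :> R[i] by rewrite pnatr_eq0.
have X_neq0 : X != 0 by apply: contraNneq X_notin => ->; rewrite mem0v.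
have OX_neq0 x : OX x -> x != 0.
  case=> g Gg <-; apply: contraNneq X_neq0 => gX0.
  by rewrite -(piK G0_group pi_rep X Gg) gX0 linear0.
pose b := central_form B0 H0.
(* The stabilizer of [pi g X] is the image under [Ad g] of that of [X]. *)
have b_stab x : OX x -> forall U, rho U x = 0 -> b U = 0.
  case=> g Gg <- U; rewrite (rho_pi G0_group G0_Lie pi_rep pi_lift) // => gU0.
  have Gg' := alggV G0_group Gg.
  rewrite -(central_form_Ad two_neq0 triplet reductive dim_center H0_center rho_H0
             G0_group G0_Lie pi_rep pi_lift U X_neq0 Gg').
  apply: (stabilizer_orthogonal two_neq0 triplet reductive dim_center H0_center
            rho_H0 X_notin).
  by rewrite -[LHS](piK G0_group pi_rep _ Gg) gU0 linear0.
have phi_covector x y : OX x -> phi B0 rho H0 x y <->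
    forall v, v \in tangent_space rho x -> y v = covector rho b x v.
  move=> Ox; rewrite phiE //; split=> [yx v /tangentP[U ->] | yx U].
    by rewrite yx covectorE //; apply: b_stab.
  by rewrite yx ?mem_tangent // covectorE //; apply: b_stab.
have phi_pi g x y : G0 g -> OX x -> phi B0 rho H0 x y ->
    phi B0 rho H0 (pi g x) (contragredient pi g y).
  move=> Gg Ox; apply: (phi_contragredient two_neq0 triplet reductive dim_center
    H0_center rho_H0 G0_group G0_Lie pi_rep pi_lift) => //; exact: OX_neq0.
split=> [x Ox||g x Gg Ox].
- exists (covector rho b x); apply/seteqP; split=> y.
    move/(phi_covector _ _ Ox) => yx; exists (y - covector rho b x).
      by move=> v Tv; rewrite add_lfunE opp_lfunE yx // subrr.
    by rewrite addrC subrK.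
  case=> z z0 <-; apply/(phi_covector _ _ Ox) => v Tv.
  by rewrite add_lfunE z0 // addr0.
- exists (fun x =>
    Defs.restrict (tangent_space rho (sval x)) (covector rho b (sval x))).
  split.
    apply: covector_section_regular b_stab => _ _ [g Gg <-] [h Gh <-].
    by rewrite !(dim_tangent_pi G0_group G0_Lie pi_rep pi_lift).
  case=> x Ox; apply/seteqP; split=> y /=.
    by move/(phi_covector _ _ Ox) => yx; apply/restrictP.
  by move/restrictP => yx; apply/phi_covector.
have Gg' := alggV G0_group Gg.
(* The reverse inclusion is transported back by [g^-1]. *)
apply/seteqP; split=> y; last by case=> z zx <-; apply: phi_pi.
move=> yx; exists (contragredient pi (invmx g) y).
  rewrite -[x](piK G0_group pi_rep _ Gg); apply: phi_pi => //.
  have [h Gh <-] := Ox; exists (g *m h); first exact: (alggM G0_group).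
  by rewrite (ratrepM pi_rep) // comp_lfunE.
apply/lfunP => v; rewrite /contragredient !comp_lfunE invmxK.
by rewrite (piKV G0_group pi_rep).
Qed.
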